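(* Let $S$ be a four-holed sphere with a pants decomposition and dual graph, with eigenvalue parameters $e_1,\dots,e_5$ and twist parameter $t_1$ as described in the context. After a right half twist of the dual graph at the $P_1$-end of the interior edge $f_1$, the new parameters $(e_1',t_1')$ of the interior edge are $$(e_1',t_1')=\left(e_1,\ -\frac{e_1(e_1e_3-e_2)}{e_1e_2-e_3}\,t_1\right).$$
   Context: Setting. $S$ is an oriented four-holed sphere, $\pi_1(S)=\langle\gamma_1,\dots,\gamma_5\mid\gamma_1\gamma_2\gamma_3=1,\ \gamma_1^{-1}\gamma_4\gamma_5=1\rangle$, where $\gamma_2,\dots,\gamma_5$ go around the four boundary components and $\gamma_1$ around the interior pants curve $c_1$, which cuts $S$ into pairs of pants $P_1$ (with $\pi_1$ generated by $\gamma_1,\gamma_2,\gamma_3$) and $P_2$ (generated by $\gamma_1,\gamma_4,\gamma_5$). The dual graph has an interior edge $f_1$ oriented from $P_1$ to $P_2$ and boundary edges $f_2,\dots,f_5$ oriented outward; the counterclockwise orders at its trivalent vertices are $(f_1,f_2,f_3)$ in $P_1$ and $(f_1,f_4,f_5)$ in $P_2$. $\rho:\pi_1(S)\to\mathrm{SL}(2,\mathbb{C})$ is a representation such that each $\rho(\gamma_i)$ has exactly two fixed points on $\mathbb{C}P^1$ and the restrictions of $\rho$ to $\langle\gamma_1,\gamma_2,\gamma_3\rangle$ and $\langle\gamma_1,\gamma_4,\gamma_5\rangle$ are irreducible (no common fixed point in $\mathbb{C}P^1$). The eigenvalue parameter $e_i$ is a chosen eigenvalue of $\rho(\gamma_i)$;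 $x_i$ (resp. $y_i$) is the fixed point given by the eigenvector for $e_i$ (resp. $e_i^{-1}$). The twist parameter $t_1\in\mathbb{C}^*$ is the unique number such that the matrix with eigenvalue $\sqrt{-t_1}$ at $x_1$ and $1/\sqrt{-t_1}$ at $y_1$ sends $x_2$ to $x_5$, i.e. $-t_1=\frac{(x_1-x_2)(y_1-x_5)}{(x_1-x_5)(y_1-x_2)}$. Right half twist: the tripod of the dual graph in $P_1$ is replaced by the mirror tripod (on the other side of $P_1$), with $f_1$ turning right by half a turn near $c_1$, so that the counterclockwise order at the vertex in $P_1$ becomes $(f_1,f_3,f_2)$. On the loops it replaces $(\gamma_1,\gamma_2,\gamma_3,\gamma_4,\gamma_5)$ by $(\gamma_1,\ \gamma_2\gamma_3\gamma_2^{-1},\ \gamma_2,\ \gamma_4,\ \gamma_5)$. The chosen eigenvalue of each pants curve is unchanged; thus $t_1'$ is the number such that the matrix with eigenvalue $\sqrt{-t_1'}$ at $x_1$ and $1/\sqrt{-t_1'}$ at $y_1$ sends $\rho(\gamma_2)x_3$ to $x_5$. *)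

(* Defs.v *)
From HB Require Import structures.
From mathcomp Require Import all_boot all_order all_algebra.
From mathcomp Require Import reals.
From mathcomp Require Import complex.

Set Implicit Arguments.
Unset Strict Implicit.
Unset Printing Implicit Defensive.

Import GRing.Theory Num.Theory passmx.
Local Open Scope ring_scope.

Inductive label : Set := i1 | i2 | i3 | i4 | i5.

(** * The fundamental group of the four-holed sphere *)

Section Group.
Local Open Scope group_scope.

Definition sphere4_relations (G : groupType) (g : label -> G) : Prop :=
  g i1 * g i2 * g i3 = 1 /\ (g i1)^-1 * g i4 * g i5 = 1.

(* The surface enters only through its fundamental group: G, marked by g, is
   < g1, ..., g5 | g1 g2 g3 = 1, g1^-1 g4 g5 = 1 >, which is expressed by the
   universal property of a presentation. *)
Definition is_pi1_sphere4 (G : groupType) (g : label -> G) : Prop :=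
  sphere4_relations g /\
  forall (H : groupType) (h : label -> H), sphere4_relations h ->
    (exists f : {multiplicative G -> H}, forall i, f (g i) = h i) /\
    (forall f1 f2 : {multiplicative G -> H},
       (forall i, f1 (g i) = h i) -> (forall i, f2 (g i) = h i) -> f1 =1 f2).

Inductive subgroup_generated (G : groupType) (S : G -> Prop) : G -> Prop :=
| sg_gen x : S x -> subgroup_generated S x
| sg_one : subgroup_generated S 1
| sg_mul x y : subgroup_generated S x -> subgroup_generated S y ->
               subgroup_generated S (x * y)
| sg_inv x : subgroup_generated S x -> subgroup_generated S x^-1.

Definition generated3 (G : groupType) (a b c : G) : G -> Prop :=
  subgroup_generated (fun x => x = a \/ x = b \/ x = c).

(* A dual graph of the pants decomposition, with its edges listed by position:
   [edge D i1] is the interior edge (oriented from P1 to P2), and the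
   counterclockwise orders at the two vertices are
     ([edge D i1], [edge D i2], [edge D i3])  in P1,
     ([edge D i1], [edge D i4], [edge D i5])  in P2.
   The value of [edge D k] is the label of the pants curve which that edge
   crosses, and [loop D k] is the loop going around this curve that is
   associated with the k-th position. *)
Record dual_graph (G : groupType) := DualGraph {
  edge : label -> label;
  loop : label -> G
}.

Definition initial_dual_graph (G : groupType) (g : label -> G) : dual_graph G :=
  DualGraph id g.

(* The half twist at the P1-end of the interior edge: the tripod in P1 is
   replaced by its mirror image, f1 turning right. *)
Definition right_half_twist (G : groupType) (D : dual_graph G) : dual_graph G :=
  DualGraph
    (fun k => match k with
              | i2 => edge D i3
              | i3 => edge D i2
              | _ => edge D k
              end)
    (fun k => match k with
              | i2 => loop D i2 * loop D i3 * (loop D i2)^-1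
              | i3 => loop D i2
              | _ => loop D k
              end).

End Group.

(** * Action of SL(2,C) on the projective line *)

Section Projective.
Variable R : realType.
Notation C := (R[i]).

Definition act (A : 'M[C]_2) : 'End('cV[C]_2) := linfun (mulmx A).

(* A point of CP^1 is a line in C^2. *)
Definition is_point (L : {vspace 'cV[C]_2}) : Prop := \dim L = 1%N.

Definition fixes (A : 'M[C]_2) (L : {vspace 'cV[C]_2}) : Prop :=
  is_point L /\ (act A @: L)%VS = L.

Definition has_exactly_two_fixed_points (A : 'M[C]_2) : Prop :=
  exists p q, p <> q /\ forall L, fixes A L <-> L = p \/ L = q.

Definition is_SL2_representation (G : groupType) (rho : G -> 'M[C]_2) : Prop :=
  [/\ forall g, \det (rho g) = 1,
      rho 1%g = 1%:M
    & forall g h, rho (g * h)%g = rho g *m rho h].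

Definition irreducible_on (G : groupType) (rho : G -> 'M[C]_2)
    (H : G -> Prop) : Prop :=
  ~ exists L, is_point L /\ forall g, H g -> fixes (rho g) L.

(* The fixed points x_k and y_k of a dual graph D, for a choice e of one
   eigenvalue for each pants curve. *)
Definition xfix (G : groupType) (rho : G -> 'M[C]_2) (e : label -> C)
    (D : dual_graph G) (k : label) : {vspace 'cV[C]_2} :=
  leigenspace (act (rho (loop D k))) (e (edge D k)).

Definition yfix (G : groupType) (rho : G -> 'M[C]_2) (e : label -> C)
    (D : dual_graph G) (k : label) : {vspace 'cV[C]_2} :=
  leigenspace (act (rho (loop D k))) (e (edge D k))^-1.

(* Replacing the square root by its opposite replaces M by - M, which acts in
   the same way on CP^1. *)
Definition is_twist_parameter (G : groupType) (rho : G -> 'M[C]_2)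
    (e : label -> C) (D : dual_graph G) (t : C) : Prop :=
  t != 0 /\
  exists M : 'M[C]_2,
    [/\ (xfix rho e D i1 <= leigenspace (act M) (sqrtC (- t)))%VS,
        (yfix rho e D i1 <= leigenspace (act M) (sqrtC (- t))^-1)%VS
      & (act M @: xfix rho e D i2)%VS = xfix rho e D i5].

Definition are_interior_parameters (G : groupType) (rho : G -> 'M[C]_2)
    (e : label -> C) (D : dual_graph G) (p : C * C) : Prop :=
  p.1 = e (edge D i1) /\ is_twist_parameter rho e D p.2.

(* After the half twist, the point x_2 is rho(g_2) x_3. *)
Lemma xfix_right_half_twist (G : groupType) (rho : G -> 'M[C]_2)
    (e : label -> C) (D : dual_graph G) :
  is_SL2_representation rho ->
  xfix rho e (right_half_twist D) i2
  = (act (rho (loop D i2)) @: xfix rho e D i3)%VS.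
Proof.
case=> _ rho1 rhoM.
have actE A v : act A v = A *m v by rewrite /act lfunE.
have eigP A a v : (v \in leigenspace (act A) a) = (A *m v == a *: v).
  by rewrite memv_ker add_lfunE opp_lfunE scale_lfunE id_lfunE actE subr_eq0.
rewrite /xfix /=; set a := loop D i2; set b := loop D i3; set c := e _.
have ra : rho (a^-1)%g *m rho a = 1%:M by rewrite -rhoM mulVg.
have ar : rho a *m rho (a^-1)%g = 1%:M by rewrite -rhoM mulgV.
apply/vspaceP => v; rewrite eigP !rhoM; apply/idP/memv_imgP.
- move=> /eqP hv; exists (rho (a^-1)%g *m v).
    rewrite eigP scalemxAr -hv !mulmxA ra mul1mx; exact/eqP.
  by rewrite actE mulmxA ar mul1mx.
- case=> u; rewrite eigP => /eqP hu ->.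
  by rewrite actE -!mulmxA (mulmxA _ _ u) ra mul1mx hu scalemxAr.
Qed.

End Projective.

(* Main.v *)
Require Import Defs.
From HB Require Import structures.
From mathcomp Require Import all_boot all_order all_algebra.
From mathcomp Require Import reals.
From mathcomp Require Import complex.
From mathcomp Require Import ring.

Set Implicit Arguments.
Unset Strict Implicit.
Unset Printing Implicit Defensive.

Import GRing.Theory Num.Theory passmx.
Local Open Scope ring_scope.

(** Let [area] be the determinant of two vectors of C^2, let x, y span the fixed
    points of A1, and let u, z, v span x_2, x_3, x_5. In the basis (x, y) the
    condition defining t says that - t is a cross-ratio:
      - t * area u y * area x v = area x u * area v y.
    The half twist replaces u by w = A2 z. Since A2 preserves areas and
    A1 A2 A3 = 1,
      e2 * area u w = area (A2 u) (A2 z) = area u z = e3 * area u (A1 w),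
    and expanding both ends in the basis (x, y) gives the ratio of the two
    cross-ratios. Irreducibility makes all the areas involved nonzero. *)

(** * Areas, cross-ratios and the effect of the twist in coordinates *)

Section Area.
Variable F : fieldType.
Implicit Types (A M : 'M[F]_2) (x y z u v w : 'cV[F]_2).

Definition area x y : F := x 0 0 * y 1 0 - x 1 0 * y 0 0.

Lemma cV2P x y : x 0 0 = y 0 0 -> x 1 0 = y 1 0 -> x = y.
Proof.
move=> h0 h1; apply/matrixP => i j; rewrite (ord1 j).
case: (unliftP 0 i) => [k ->|-> //]; rewrite (ord1 k).
by have -> : lift 0 0 = 1 :> 'I_2 by apply: val_inj.
Qed.

Lemma det_mx2 A : \det A = A 0 0 * A 1 1 - A 0 1 * A 1 0.
Proof.
rewrite (expand_det_row _ 0) !big_ord_recl big_ord0 addr0 /cofactor !det_mx11.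
rewrite !mxE /= expr0 expr1 mul1r mulN1r mulrN.
by congr (_ * A _ _ - A _ _ * A _ _); apply: val_inj.
Qed.

Lemma mulmx2E A x i : (A *m x) i 0 = A i 0 * x 0 0 + A i 1 * x 1 0.
Proof. rewrite mxE !big_ord_recl big_ord0 addr0.
by congr (_ + A _ _ * x _ _); apply: val_inj. Qed.

Lemma area_mulmx A x y : area (A *m x) (A *m y) = \det A * area x y.
Proof. by rewrite det_mx2 /area !mulmx2E; ring. Qed.

Lemma areaZl a x y : area (a *: x) y = a * area x y.
Proof. by rewrite /area !mxE; ring. Qed.

Lemma areaZr a x y : area x (a *: y) = a * area x y.
Proof. by rewrite /area !mxE; ring. Qed.

Lemma areaC x y : area y x = - area x y.
Proof. by rewrite /area; ring. Qed.

(** Cramer's rule with its denominator cleared: the coordinates of [z] in the basis ([x], [y]). *)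
Lemma area_cramer x y z :
  area x y *: z = area z y *: x + area x z *: y.
Proof. by apply: cV2P; rewrite !mxE /area; ring. Qed.

Lemma area_eq0 x y : x != 0 -> area x y = 0 -> exists c, y = c *: x.
Proof.
(* Some standard basis vector [z] is independent of [x]. In Cramer's rule for [y] in the basis ([x],
   [z]), the coefficient of [z] is [area x y], which vanishes. *)
move=> x0 xy0; have [z xz] : exists z, area x z != 0.
  have [h0|h0] := eqVneq (x 0 0) 0.
    exists (delta_mx 0 0); rewrite /area !mxE !eqxx /= mulr0 sub0r mulr1 oppr_eq0.
    by apply: contra_neq x0 => h1; apply: cV2P; rewrite !mxE.
  by exists (delta_mx 1 0); rewrite /area !mxE !eqxx /= mulr0 subr0 mulr1.
exists ((area x z)^-1 * area y z).
have := area_cramer x z y; rewrite xy0 scale0r addr0.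
by move/(congr1 (fun t => (area x z)^-1 *: t)); rewrite !scalerA mulVf // scale1r.
Qed.

(** Apply [M] to the Cramer decomposition of [u] and take the area against [v]: the side
    proportional to [v] vanishes, and the two remaining terms balance. *)
Lemma stretch_area M x y u v (s c : F) : area x y != 0 -> s != 0 ->
  M *m x = s *: x -> M *m y = s^-1 *: y -> M *m u = c *: v ->
  s ^+ 2 * (area u y * area x v) = area x u * area v y.
Proof.
move=> xy0 s0 Mx My Mu; have := congr1 (mulmx M) (area_cramer x y u).
rewrite mulmxDr -!scalemxAr Mx My Mu => /(congr1 (fun z => area z v)).
have -> : area (area x y *: (c *: v)) v = 0 by rewrite /area !mxE; ring.
rewrite (_ : area (_ + _) v =
  area u y * s * area x v - area x u * s^-1 * area v y); last first.
  by rewrite /area !mxE; ring.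
move/eqP; rewrite eq_sym subr_eq0 => /eqP h.
rewrite (_ : _ * _ = s * (area u y * s * area x v)); last by ring.
by rewrite h; field.
Qed.

Lemma stretch_exists x y (s : F) : area x y != 0 ->
  exists M, M *m x = s *: x /\ M *m y = s^-1 *: y.
Proof.
move=> xy0; pose f j := delta_mx j 0 : 'cV[F]_2.
(* Column [j] is the prescribed image of the basis vector [f j], read off from its Cramer
   decomposition. *)
exists (\matrix_(i, j) ((area x y)^-1 * (s * area (f j) y * x i 0
                                  + s^-1 * area x (f j) * y i 0))).
by split; apply: cV2P; rewrite mulmx2E !mxE /area !mxE /=; move: xy0;
  rewrite /area; set t := s^-1; move=> xy0; field.
Qed.

(** The last hypothesis is A1 A2 A3 = 1 applied to an eigenvector [z] of A3 for [e3], so A3 itself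
    does not appear. *)
Lemma twist_ratio A1 A2 x y u w z (a e2 e3 : F) :
  \det A2 = 1 -> area x y != 0 -> a != 0 ->
  A1 *m x = a *: x -> A1 *m y = a^-1 *: y -> A2 *m u = e2 *: u ->
  w = A2 *m z -> e3 *: (A1 *m w) = z ->
  area x w * area u y * (a * e2 - e3)
    = - (a * (a * e3 - e2)) * (area x u * area w y).
Proof.
move=> dA xy0 a0 A1x A1y A2u wE zE.
have uw : e2 * area u w = e3 * area u (A1 *m w).
  by rewrite -[RHS]areaZr zE -areaZl -A2u wE area_mulmx dA mul1r.
have xyw : area x y * area u w = area u y * area x w - area x u * area w y.
  by rewrite /area; ring.
have xyAw : area x y * area u (A1 *m w)
    = area u y * area x w / a - area x u * area w y * a.
  rewrite -[LHS]areaZr scalemxAr area_cramer mulmxDr -!scalemxAr A1x A1y.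
  by rewrite /area !mxE; field.
have h : e2 * (area x y * area u w) = e3 * (area x y * area u (A1 *m w)).
  by rewrite !(mulrCA _ (area x y)) uw.
rewrite xyw xyAw in h.
apply/eqP; rewrite -subr_eq0; apply/eqP.
rewrite (_ : _ - _ = a * (e2 * (area u y * area x w - area x u * area w y)
  - e3 * (area u y * area x w / a - area x u * area w y * a))); last by field.
by rewrite h subrr mulr0.
Qed.

(** Both cross-ratios involve the same [v], so the factors [area v y] and [area x v] cancel in their
    quotient, which is [k]. *)
Lemma twist_equation_ratio x y u w v (t t' k : F) :
  area x v != 0 -> area u y != 0 -> area w y != 0 ->
  area x w * area u y = k * (area x u * area w y) ->
  - t * (area u y * area x v) = area x u * area v y ->
  - t' * (area w y * area x v) = area x w * area v y <-> t' = k * t.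
Proof.
move=> xv0 uy0 wy0 kE tE.
have -> : area x w * area v y = - (k * t) * (area w y * area x v).
  apply: (mulfI uy0); transitivity (area x w * area u y * area v y); first by ring.
  rewrite kE; transitivity (k * area w y * (area x u * area v y)); first by ring.
  by rewrite -tE; ring.
by split=> [/(mulIf (mulf_neq0 wy0 xv0))/oppr_inj|->].
Qed.

End Area.

(** * Fixed points as lines, the twist equation and irreducibility *)

Section Lines.
Variable R : realType.
Notation C := (R[i]).
Implicit Types (A M : 'M[C]_2) (x y z u v w : 'cV[C]_2) (L : {vspace 'cV[C]_2}).

Lemma actE A v : act A v = A *m v.
Proof. by rewrite /act lfunE. Qed.

Lemma mem_leigenspace_act A a v :
  (v \in leigenspace (act A) a) = (A *m v == a *: v).
Proof.
by rewrite memv_ker add_lfunE opp_lfunE scale_lfunE id_lfunE actE subr_eq0.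
Qed.

Lemma vlineZ (c : C) v : c != 0 -> <[c *: v]>%VS = <[v]>%VS.
Proof.
move=> c0; apply/vspaceP => z; apply/vlineP/vlineP => -[k ->].
  by exists (k * c); rewrite scalerA.
by exists (k / c); rewrite scalerA divfK.
Qed.

Lemma area_line0 x y : x != 0 -> y != 0 ->
  area x y = 0 -> <[x]>%VS = <[y]>%VS.
Proof.
move=> x0 y0 /(area_eq0 x0)[c yE]; rewrite yE vlineZ //.
by apply: contra_neq y0 => c0; rewrite yE c0 scale0r.
Qed.

Lemma line_area0 x y : <[x]>%VS = <[y]>%VS -> area x y = 0.
Proof.
move=> xy; have /vlineP[c ->] : x \in <[y]>%VS by rewrite -xy memv_line.
by rewrite /area !mxE; ring.
Qed.

Lemma eigen_neq0 A a v : \det A = 1 -> v != 0 -> A *m v = a *: v -> a != 0.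
Proof.
move=> dA v0 Av; apply: contra_neq v0 => a0.
have uA : A \in unitmx by rewrite unitmxE dA unitr1.
by rewrite -[v](mulKmx uA) Av a0 scale0r mulmx0.
Qed.

Lemma fixes_line A a v : v != 0 -> a != 0 -> A *m v = a *: v ->
  fixes A <[v]>%VS.
Proof.
move=> v0 a0 Av; split; first by rewrite /is_point dim_vline v0.
by rewrite limg_line actE Av vlineZ.
Qed.

Lemma fixesE A L : fixes A L ->
  exists v a, [/\ v != 0, L = <[v]>%VS & A *m v = a *: v].
Proof.
case=> dL AL; exists (vpick L).
have v0 : vpick L != 0 by rewrite vpick0 -dimv_eq0 dL.
have LE : L = <[vpick L]>%VS.
  apply/esym/eqP; rewrite eqEdim -memvE memv_pick dim_vline v0.
  by rewrite dL.
have : act A (vpick L) \in L by rewrite -{2}AL memv_img ?memv_pick.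
by rewrite {2}LE => /vlineP[a]; rewrite actE => Av; exists a.
Qed.

Lemma fixesM A B L : fixes A L -> fixes B L -> fixes (A *m B) L.
Proof.
case=> dL AL [_ BL]; split=> //.
have -> : act (A *m B) = (act A \o act B)%VF.
  by apply/lfunP => v; rewrite comp_lfunE !actE mulmxA.
by rewrite limg_comp BL.
Qed.

Lemma fixesV A B L : B *m A = 1%:M -> fixes A L -> fixes B L.
Proof.
move=> BA [dL AL]; split=> //; rewrite -{1}AL -limg_comp.
have -> : (act B \o act A)%VF = \1%VF.
  by apply/lfunP => v; rewrite comp_lfunE !actE mulmxA BA mul1mx id_lfunE.
by rewrite lim1g.
Qed.

(** One of the two fixed lines is spanned by an eigenvector for [a]. Since [A] preserves areas, the
    eigenvalue on the other is [a^-1]. Having only two fixed lines excludes a^2 = 1, and this makes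
    both eigenspaces lines. *)
Lemma eigenlines A a : \det A = 1 -> has_exactly_two_fixed_points A ->
  leigenvalue (act A) a ->
  exists x y, [/\ area x y != 0, leigenspace (act A) a = <[x]>%VS &
                  leigenspace (act A) a^-1 = <[y]>%VS].
Proof.
move=> dA [p [q [pq fixA]]] ev; pose x := vpick (leigenspace (act A) a).
have x0 : x != 0 by rewrite vpick0.
have Ax : A *m x = a *: x.
  by apply/eqP; rewrite -mem_leigenspace_act memv_pick.
have a0 := eigen_neq0 dA x0 Ax.
have [L Lx fixA'] : exists2 L, <[x]>%VS <> L &
    forall K, fixes A K <-> K = <[x]>%VS \/ K = L.
  have /fixA[xp|xq] := fixes_line x0 a0 Ax.
    by exists q; rewrite xp.
  exists p; rewrite xq; first exact/nesym.
  by move=> K; rewrite fixA; split=> -[]; auto.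
have /fixesE[y [b [y0 LE Ay]]] : fixes A L by apply/fixA'; right.
rewrite {}LE in Lx fixA'.
have xy0 : area x y != 0 by apply/eqP => /(area_line0 x0 y0).
have areaA u v : area (A *m u) (A *m v) = area u v.
  by rewrite area_mulmx dA mul1r.
have ab : a * b = 1.
  by apply: (mulIf xy0); rewrite mul1r -{2}areaA Ax Ay areaZl areaZr mulrA.
have bE : b = a^-1 by rewrite -[b](mulKf a0) ab mulr1.
(* If a * a = 1 then a = b, so A is scalar and fixes the third line <[x + y]>. *)
have aa : a * a != 1.
  apply/eqP => aa; have ba : b = a by rewrite -[b](mulKf a0) ab -aa mulKf.
  have xy_area : area x (x + y) != 0.
    by rewrite (_ : area _ _ = area x y) // /area !mxE; ring.
  have yx_area : area (x + y) y != 0.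
    by rewrite (_ : area _ _ = area x y) // /area !mxE; ring.
  have xDy0 : x + y != 0.
    by apply: contra_neq xy_area => ->; rewrite /area !mxE !mulr0 subrr.
  have /fixA'[] : fixes A <[x + y]>%VS.
    by apply: (fixes_line xDy0 a0); rewrite mulmxDr Ax Ay ba scalerDr.
    by move/esym/line_area0/eqP; apply/negP.
  by move/line_area0/eqP; apply/negP.
(* Two eigenvectors for [c] span an area that [A] both preserves and multiplies by c^2, so it is
   zero. *)
have eig c z : z != 0 -> A *m z = c *: z -> c * c != 1 ->
    leigenspace (act A) c = <[z]>%VS.
  move=> z0 Az cc; apply/vspaceP => w; rewrite mem_leigenspace_act.
  apply/eqP/vlineP => [Aw|[k ->]]; last by rewrite -scalemxAr Az !scalerA mulrC.
  apply: area_eq0 => //; apply/eqP.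
  have : (c * c - 1) * area z w = 0.
    by rewrite mulrBl mul1r -{2}areaA Az Aw areaZl areaZr mulrA subrr.
  by move/eqP; rewrite mulf_eq0 subr_eq0 (negbTE cc).
exists x, y; split=> //; first exact: eig.
apply: eig => //; first by rewrite -bE.
by rewrite -invfM invr_eq1.
Qed.

(** The cross-ratio formula for -t in homogeneous coordinates, so that the point at infinity of the
    projective line is covered. *)
Definition twist_equation (x y u v : 'cV[C]_2) (t : C) :=
  - t * (area u y * area x v) = area x u * area v y.

Lemma twist_parameterE (G : groupType) (rho : G -> 'M[C]_2) e (D : dual_graph G)
    x y u v t :
  area x y != 0 -> v != 0 -> area u y != 0 ->
  xfix rho e D i1 = <[x]>%VS -> yfix rho e D i1 = <[y]>%VS ->
  xfix rho e D i2 = <[u]>%VS -> xfix rho e D i5 = <[v]>%VS ->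
  is_twist_parameter rho e D t <-> t != 0 /\ twist_equation x y u v t.
Proof.
move=> xy0 v0 uy0 xE yE uE vE.
rewrite /is_twist_parameter xE yE uE vE /twist_equation.
have sq : sqrtC (- t) ^+ 2 = - t by rewrite sqrtCK.
have s0 : t != 0 -> sqrtC (- t) != 0 by rewrite sqrtC_eq0 oppr_eq0.
(* Only s^2 = -t and s nonzero are kept, so the choice of the root does not matter. *)
move: (sqrtC (- t)) sq s0 => s sq s0.
split=> -[t0 H]; split=> //; have {}s0 := s0 t0.
  have [M []] := H; rewrite -!memvE !mem_leigenspace_act => /eqP Mx /eqP My.
  rewrite limg_line actE => uv.
  have /vlineP[c Mu] : M *m u \in <[v]>%VS by rewrite -uv memv_line.
  by have := stretch_area xy0 s0 Mx My Mu; rewrite sq.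
have [M [Mx My]] := stretch_exists s xy0; exists M.
rewrite -!memvE !mem_leigenspace_act Mx My !eqxx; split=> //.
rewrite limg_line actE.
have Mu : area x y *: (M *m u) = (area u y * s) *: x + (area x u / s) *: y.
  by rewrite scalemxAr area_cramer mulmxDr -!scalemxAr Mx My !scalerA.
(* If [M *m u] vanished, so would its coefficient along [x], hence [area u y]. *)
have Mu0 : M *m u != 0.
  apply: contra_neq uy0 => Mu0; move: Mu; rewrite Mu0 scaler0.
  move/(congr1 (fun z => area z y)).
  rewrite (_ : area 0 y = 0); last by rewrite /area !mxE !mul0r subrr.
  rewrite (_ : area (_ + _) y = area u y * s * area x y); last first.
    by rewrite /area !mxE; ring.
  by move/esym/eqP; rewrite !mulf_eq0 (negbTE s0) (negbTE xy0) !orbF => /eqP.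
apply: area_line0 => //; apply: (mulfI xy0); rewrite mulr0 -areaZl Mu.
rewrite (_ : area _ _ = area u y * s * area x v - area x u / s * area v y).
  rewrite (_ : _ - _ =
    s^-1 * (s ^+ 2 * (area u y * area x v) - area x u * area v y)).
    by rewrite sq H subrr mulr0.
  by field.
by rewrite /area !mxE; ring.
Qed.

Lemma fixes_subgroup (G : groupType) (rho : G -> 'M[C]_2) (S : G -> Prop) L g :
  is_SL2_representation rho -> is_point L ->
  (forall h, S h -> fixes (rho h) L) -> subgroup_generated S g ->
  fixes (rho g) L.
Proof.
move=> [_ rho1 rhoM] pL fS; elim=> {g} [g Sg||g h _ fg _ fh|g _ fg].
- exact: fS.
- split=> //; have -> : act (rho 1%g) = \1%VF.
    by apply/lfunP => v; rewrite actE rho1 mul1mx id_lfunE.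
  by rewrite lim1g.
- by rewrite rhoM; apply: fixesM.
- by apply: fixesV fg; rewrite -rhoM mulVg.
Qed.

(** If the two eigenvectors were proportional, their common line would be fixed by [g] and [h],
    hence by [a], [b], [c], against irreducibility. [generated3 g h h] stands for the subgroup
    generated by two elements. *)
Lemma irreducible_area (G : groupType) (rho : G -> 'M[C]_2) (g h a b c : G)
    (l m : C) z u :
  is_SL2_representation rho -> irreducible_on rho (generated3 a b c) ->
  generated3 g h h a -> generated3 g h h b -> generated3 g h h c ->
  z != 0 -> u != 0 -> rho g *m z = l *: z -> rho h *m u = m *: u ->
  area z u != 0.
Proof.
move=> srho irr ga gb gc z0 u0 gz hu; apply/eqP => zu0; apply: irr.
have [det1 _ _] := srho.
have zu := area_line0 z0 u0 zu0.
have pz : is_point <[z]>%VS by rewrite /is_point dim_vline z0.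
have fg : fixes (rho g) <[z]>%VS.
  exact: fixes_line z0 (eigen_neq0 (det1 _) z0 gz) gz.
have fh : fixes (rho h) <[z]>%VS.
  by rewrite zu; apply: fixes_line u0 (eigen_neq0 (det1 _) u0 hu) hu.
have fgh k : generated3 g h h k -> fixes (rho k) <[z]>%VS.
  by apply: fixes_subgroup => // _ [|[]] ->.
exists <[z]>%VS; split=> // k; apply: fixes_subgroup => // _ [|[]] ->; exact: fgh.
Qed.

End Lines.

(** * The half twist on the four-holed sphere *)

Theorem proposition10p7 (R : realType) (pi1S : groupType)
    (gamma : label -> pi1S) (rho : pi1S -> 'M[R[i]]_2)
    (e : label -> R[i]) (t1 : R[i]) :
  is_pi1_sphere4 gamma ->
  is_SL2_representation rho ->
  (forall k, has_exactly_two_fixed_points (rho (gamma k))) ->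
  irreducible_on rho (generated3 (gamma i1) (gamma i2) (gamma i3)) ->
  irreducible_on rho (generated3 (gamma i1) (gamma i4) (gamma i5)) ->
  (forall k, leigenvalue (act (rho (gamma k))) (e k)) ->
  are_interior_parameters rho e (initial_dual_graph gamma) (e i1, t1) ->
  forall e1' t1' : R[i],
    are_interior_parameters rho e (right_half_twist (initial_dual_graph gamma))
      (e1', t1')
    <-> (e1', t1')
        = (e i1,
           - (e i1 * (e i1 * e i3 - e i2) / (e i1 * e i2 - e i3)) * t1).
Proof.
move=> [[rel1 rel2] _] srho two irr1 irr2 ev [_ tw1] e1' t1'.
have [det1 rho1 rhoM] := srho.
set A := fun k => rho (gamma k).
have [x [y [xy0 xE yE]]] := eigenlines (det1 _) (two i1) (ev i1).
have line k : exists2 u, u != 0 & leigenspace (act (A k)) (e k) = <[u]>%VS.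
  have [u [w [uw0 uE _]]] := eigenlines (det1 _) (two k) (ev k).
  by exists u => //; apply: contra_neq uw0 => ->; rewrite /area !mxE !mul0r subrr.
have [u u0 uE] := line i2; have [z z0 zE] := line i3; have [v v0 vE] := line i5.
have eigE k a q : leigenspace (act (A k)) a = <[q]>%VS -> A k *m q = a *: q.
  by move=> E; apply/eqP; rewrite -mem_leigenspace_act E memv_line.
have x0 : x != 0 by apply: contra_neq xy0 => ->; rewrite /area !mxE !mul0r subrr.
have y0 : y != 0 by apply: contra_neq xy0 => ->; rewrite /area !mxE !mulr0 subrr.
have Ax := eigE _ _ _ xE; have Ay := eigE _ _ _ yE.
have Au := eigE _ _ _ uE; have Az := eigE _ _ _ zE; have Av := eigE _ _ _ vE.
have a0 : e i1 != 0 := eigen_neq0 (det1 _) x0 Ax.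
have c0 : e i3 != 0 := eigen_neq0 (det1 _) z0 Az.
have gen1 g h : @generated3 pi1S g h h g by apply: sg_gen; left.
have gen2 g h : @generated3 pi1S g h h h by apply: sg_gen; right; left.
(* The relations show that each pants group is generated by [gamma i1] and one boundary loop, so
   irreducibility separates the fixed points of [A i1] from [u], [z] and [v]. *)
have g3E : gamma i3 = ((gamma i1 * gamma i2)^-1)%g.
  by rewrite -[gamma i3](mulKg (gamma i1 * gamma i2)%g) rel1 mulg1.
have g2E : gamma i2 = ((gamma i1)^-1 * (gamma i3)^-1)%g.
  by rewrite g3E invgK mulKg.
have g4E : gamma i4 = (gamma i1 * (gamma i5)^-1)%g.
  have := congr1 (fun h => gamma i1 * h * (gamma i5)^-1)%g rel2.
  by rewrite mulg1 !mulgA mulgV mul1g mulgK.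
have ind2 l q : q != 0 -> A i1 *m q = l *: q -> area q u != 0.
  move=> q0 Aq; apply: (irreducible_area srho irr1) q0 u0 Aq Au => //.
  by rewrite g3E; apply/sg_inv/sg_mul; [apply: gen1|apply: gen2].
have ind3 l q : q != 0 -> A i1 *m q = l *: q -> area q z != 0.
  move=> q0 Aq; apply: (irreducible_area srho irr1) q0 z0 Aq Az => //.
  by rewrite g2E; apply: sg_mul; apply: sg_inv; [apply: gen1|apply: gen2].
have ind5 l q : q != 0 -> A i1 *m q = l *: q -> area q v != 0.
  move=> q0 Aq; apply: (irreducible_area srho irr2) q0 v0 Aq Av => //.
  by rewrite g4E; apply: sg_mul; [apply: gen1|apply/sg_inv/gen2].
set w := A i2 *m z.
have wE : e i3 *: (A i1 *m w) = z.
  rewrite scalemxAr /w scalemxAr -Az /A !mulmxA -!rhoM.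
  by rewrite rel1 rho1 mul1mx.
(* [A i1] preserves the line of [q] and sends [w] to the line of [z], so this reduces to [ind3]. *)
have indw l q : q != 0 -> A i1 *m q = l *: q -> area q w != 0.
  move=> q0 Aq; have := ind3 l q q0 Aq; rewrite -wE areaZr; apply: contra_neq => qw0.
  have l0 := eigen_neq0 (det1 _) q0 Aq.
  have : area (A i1 *m q) (A i1 *m w) = 0 by rewrite area_mulmx qw0 mulr0.
  rewrite Aq areaZl => /eqP; rewrite mulf_eq0 (negbTE l0) /= => /eqP ->.
  by rewrite mulr0.
have uy0 : area u y != 0 by rewrite areaC oppr_eq0; apply: ind2 Ay.
have wy0 : area w y != 0 by rewrite areaC oppr_eq0; apply: indw Ay.
have vy0 : area v y != 0 by rewrite areaC oppr_eq0; apply: ind5 Ay.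
have xu0 := ind2 _ _ x0 Ax; have xv0 := ind5 _ _ x0 Ax; have xw0 := indw _ _ x0 Ax.
have ratio := twist_ratio (det1 _) xy0 a0 Ax Ay Au (erefl w) wE.
set N := e i1 * e i2 - e i3 in ratio *; set K := e i1 * _ in ratio *.
(* If [N] vanished, [ratio] would force e1 e3 = e2. Together with e1 e2 = e3 this gives e1^2 = 1, so
   the lines of [x] and [y] would coincide. *)
have N0 : N != 0.
  apply/eqP => N0; move: ratio; rewrite N0 mulr0 => /esym/eqP.
  rewrite !mulf_eq0 (negbTE xu0) (negbTE wy0) !orbF oppr_eq0.
  rewrite mulf_eq0 (negbTE a0) subr_eq0 => /eqP a3.
  have aa : e i1 * e i1 = 1.
    apply: (mulIf c0); rewrite -mulrA a3 mul1r.
    by apply/eqP; rewrite -subr_eq0 -/N N0.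
  have aV : (e i1)^-1 = e i1 by rewrite -[LHS]mulr1 -aa mulKf.
  have : <[x]>%VS = <[y]>%VS by rewrite -xE -yE aV.
  by move/line_area0/eqP; apply/negP.
have [t10 eq1] := (twist_parameterE t1 xy0 v0 uy0 xE yE uE vE).1 tw1.
pose D' := right_half_twist (initial_dual_graph gamma).
have w_line : xfix rho e D' i2 = <[w]>%VS.
  by rewrite xfix_right_half_twist // [xfix _ _ _ _]zE limg_line actE.
(* The twist changes neither the loops nor the eigenvalues at [i1] and [i5], so [xE], [yE] and [vE]
   still apply. *)
have twE := @twist_parameterE _ _ rho e D' _ _ _ _ t1' xy0 v0 wy0 xE yE w_line vE.
have kE : area x w * area u y = - (K / N) * (area x u * area w y).
  by apply: (mulIf N0); rewrite ratio; field.
have eqE := twist_equation_ratio t1' xv0 uy0 wy0 kE eq1.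
split; first by case=> /= -> /twE[_ /eqE ->].
case=> -> t1E; have eq1' := eqE.2 t1E.
split; [by [] | apply: twE.2; split; last exact: eq1'].
(* The new parameter is nonzero because the right side of its twist equation, [area x w * area v y],
   is nonzero. *)
by apply: contra_neq (mulf_neq0 xw0 vy0) => t0; rewrite -eq1' t0 oppr0 mul0r.
Qed.
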